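(* Let $i_1,\dots,i_k$ be distinct positive integers and $p_1,\dots,p_k>0$ with $p_1+\dots+p_k=1$; a ''die'' shows $i_r$ with probability $p_r$. For a positive integer $n$, in the solitaire game one starts with capital $0$ and repeatedly rolls the die, adding the outcome to the capital, until the capital is $\ge n$; let $b_{j,n}$ be the probability that this takes exactly $j$ rolls. In the two-player game the players alternately roll the die, each accumulating their own capital starting from $0$ (rolls independent), and the first to reach capital $\ge n$ wins. Let $f(n)$ be the probability that the player who moves first wins. Then $f(n)=(1+a(n))/2$ with $a(n)=\sum_{j\ge1}b_{j,n}^2$, and the sequence $a(n)$ (hence also $f(n)$) is P-recursive: there exist an integer $L\ge1$ and polynomials $c_0(n),\dots,c_L(n)$, not all zero, such that $\sum_{i=0}^{L}c_i(n)\,a(n-i)=0$ for all $n> L$. *)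

(* Defs.v *)
From HB Require Import structures.
From mathcomp Require Import all_boot all_order all_algebra.
From mathcomp Require Import finmap.
From mathcomp Require Import all_classical all_reals all_analysis.
Set Implicit Arguments.
Unset Strict Implicit.
Unset Printing Implicit Defensive.
Import Order.TTheory GRing.Theory Num.Theory.
Local Open Scope classical_set_scope.
Local Open Scope ring_scope.

Definition mutually_independent (R : realType) (d d' : measure_display)
    (T : measurableType d) (E : measurableType d') (P : probability T R)
    (I : choiceType) (X : I -> {RV P >-> E}) : Prop :=
  forall (J : {fset I}) (A : I -> set E),
    (forall i, measurable (A i)) ->
    P (\bigcap_(i in [set` J]) (X i @^-1` A i)) =
    (\prod_(i <- J) P (X i @^-1` A i))%E.

(* [X t] is the outcome of roll number [t], with rolls numbered from 0. *)
Definition die_rolls (R : realType) (d : measure_display)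
    (T : measurableType d) (P : probability T R) (k : nat)
    (face : 'I_k -> nat) (p : 'I_k -> R) (X : nat -> {RV P >-> nat}) : Prop :=
  mutually_independent X /\
  forall (t : nat) (r : 'I_k), P [set w | X t w = face r] = (p r)%:E.

Section Games.
Variables (R : realType) (d : measure_display) (T : measurableType d).
Variables (P : probability T R) (X : nat -> {RV P >-> nat}).

Definition capital (j : nat) (w : T) : nat := (\sum_(t < j) X t w)%N.

Definition solitaire_takes (n j : nat) : set T :=
  [set w | (n <= capital j w)%N /\
           forall i : nat, (i < j)%N -> (capital i w < n)%N].

Definition solitaire_prob (j n : nat) : R := fine (P (solitaire_takes n j)).

(* In the two-player game the same sequence of rolls is used alternately: the
   first mover ([second = false]) makes the rolls of even number, the other
   player those of odd number. [t] counts the rolls made by both players. *)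
Definition player_capital (second : bool) (t : nat) (w : T) : nat :=
  (\sum_(u < t | odd u == second) X u w)%N.

(* At some moment the first mover has reached [n] while the opponent has not. *)
Definition first_wins (n : nat) : set T :=
  [set w | exists t : nat, (n <= player_capital false t w)%N /\
                           (player_capital true t w < n)%N].

Definition first_win_prob (n : nat) : R := fine (P (first_wins n)).

(* The outcomes being positive, the terms with [j > n] vanish, so that the
   limit of the partial sums exists. *)
Definition sum_sq_prob (n : nat) : R :=
  \big[+%R/0]_(1 <= j <oo) (solitaire_prob j n) ^+ 2.

End Games.

(* Only the values [u m] with [m >= 1] are involved. *)
Definition P_recursive (R : realType) (u : nat -> R) : Prop :=
  exists L : nat, (1 <= L)%N /\
  exists c : 'I_L.+1 -> {poly R},
    (exists i, c i != 0) /\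
    forall n : nat, (L < n)%N ->
      \sum_(i < L.+1) (c i).[n%:R] * u (n - i)%N = 0.

(* Main.v *)
Require Import Defs.
From HB Require Import structures.
From mathcomp Require Import all_boot all_order all_algebra.
From mathcomp Require Import finmap ring lra zify.
From mathcomp Require Import all_classical all_reals all_analysis.
Set Implicit Arguments.
Unset Strict Implicit.
Unset Printing Implicit Defensive.
Import Order.TTheory GRing.Theory Num.Theory.
Local Open Scope classical_set_scope.
Local Open Scope ring_scope.

(** Let g(x) be the generating polynomial of the die, so that the j-th capital
    has law [x^z] g(x)^j. Then a(n) is the diagonal coefficient of
    F(x, y) = sum_j b_{j+1}(x) b_{j+1}(y), a polynomial combination of shifts of
    1 / (1 - g(x) g(y)). Following Lipshitz, one applies to F differential
    operators in s = x and t = x y with coefficients in t only: the operators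
    of order at most N form a family of size of order N^3, but their values
    are polynomials of degree O(N) over a fixed power of 1 - g(x) g(y), a space
    of dimension O(N^2). A dependence relation, restricted to the diagonal,
    is the recurrence.

    Writing B_j for the probability that the capital after j rolls is still
    below n, the first player wins with probability
    sum_j (B_j - B_{j+1}) B_j, and 2 (B_j - B_{j+1}) B_j =
    B_j^2 - B_{j+1}^2 + (B_j - B_{j+1})^2 telescopes to 1 + a(n). *)

(** * Diagonal of the generating function *)

(** The matrix [M] has fewer columns than rows, so its left kernel is nonzero; [q] is read off a
    nonzero row of [kermx M]. *)
Lemma linear_dependence (K : fieldType) (I J : finType) (w : I -> J -> K) :
  (#|J| < #|I|)%N ->
  exists q : I -> K, (exists i, q i != 0) /\
    forall j, \sum_i q i * w i j = 0.
Proof.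
move=> ltJI.
pose M : 'M[K]_(#|I|, #|J|) := \matrix_(i, j) w (enum_val i) (enum_val j).
have kerN0 : kermx M != 0.
  rewrite kermx_eq0 /row_free neq_ltn.
  by rewrite (leq_ltn_trans (rank_leq_col M) ltJI).
have [i rowN0] : exists i, row i (kermx M) != 0.
  apply/existsP; rewrite -negb_forall; apply: contra kerN0 => /forallP rows0.
  by apply/eqP/row_matrixP => i; rewrite row0; apply/eqP/rows0.
pose u := row i (kermx M).
have uM : u *m M = 0 by apply/eqP; rewrite -sub_kermx row_sub.
exists (fun x => u 0 (enum_rank x)); split.
  have /rV0Pn[j uj] : u != 0 by [].
  by exists (enum_val j); rewrite enum_valK.
move=> j; have /matrixP/(_ 0 (enum_rank j)) := uM.
rewrite !mxE => {2}<-; rewrite (reindex enum_rank) /=; last first.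
  by apply: onW_bij; exact: enum_rank_bij.
by apply: eq_bigr => x _; rewrite [M _ _]mxE !enum_rankK.
Qed.

(** * Coefficients of g(x)^j and of the powers of 1 / (1 - g(x) g(y)) *)

Section DieLaw.
Variables (R : numFieldType) (k : nat) (face : 'I_k -> nat) (p : 'I_k -> R).

Definition die_poly : {poly R} := \sum_(r < k) p r *: 'X^(face r).

(** Indices range over [int], with value 0 at negative ones, so that shifts carry no side
    conditions. *)
Definition law (j : nat) (z : int) : R :=
  if z is Posz m then (die_poly ^+ j)`_m else 0.

Lemma law0 z : law 0 z = (z == 0)%:R.
Proof. by case: z => m; rewrite //= expr0 coef1. Qed.

Lemma lawS j z : law j.+1 z = \sum_(r < k) p r * law j (z - (face r)%:Z).
Proof.
case: z => m; last first.
  rewrite big1 // => r _; case E: (_ - _) => [n|n]; last by rewrite mulr0.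
  by exfalso; lia.
rewrite /= exprS [die_poly in LHS]/die_poly mulr_suml coef_sum.
apply: eq_bigr => r _; rewrite -scalerAl coefZ coefXnM; congr (_ * _).
case: ltnP => h; last by rewrite subzn.
by case E: (_ - _) => [n|n] //; exfalso; lia.
Qed.

(** Coefficient form of x (g^(j+1))' = (j+1) g^j x g', proved by induction on [j] with the product
    rule. *)
Lemma mul_lawS j z :
  z%:~R * law j.+1 z =
  j.+1%:R * \sum_(r < k) p r * (face r)%:R * law j (z - (face r)%:Z).
Proof.
elim: j z => [|j IH] z; rewrite lawS.
  rewrite mul1r mulr_sumr; apply: eq_bigr => r _; rewrite law0.
  have [/eqP|] := eqVneq; last by rewrite !mulr0.
  by rewrite subr_eq0 => /eqP ->; rewrite !mulr1 -pmulrn mulrC.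
transitivity (\sum_(r < k) (p r * ((z - (face r)%:Z)%:~R * law j.+1 (z - (face r)%:Z))
   + p r * (face r)%:R * law j.+1 (z - (face r)%:Z))).
  rewrite mulr_sumr; apply: eq_bigr => r _; rewrite rmorphB /= -pmulrn; ring.
rewrite big_split /= -[j.+2]addn1 natrD mulrDl mul1r; congr (_ + _).
under eq_bigr do rewrite IH mulrCA mulr_sumr.
rewrite -mulr_sumr exchange_big /=; congr (_ * _); apply: eq_bigr => s _.
rewrite lawS !mulr_sumr; apply: eq_bigr => r _.
by rewrite mulrCA addrAC.
Qed.

Hypothesis face_gt0 : forall r, (0 < face r)%N.

(** As all faces are positive, x divides g and x^j divides g^j. *)
Lemma law_eq0 j z : z < j%:Z -> law j z = 0.
Proof.
elim: j z => [|j IH] z ltzj; first by rewrite law0; case: eqP => // z0; lia.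
rewrite lawS big1 // => r _; rewrite IH ?mulr0 //.
by have := face_gt0 r; lia.
Qed.

(* The coefficient of x^m y^n in 1 / (1 - g(x) g(y)) ^ (a + 1), where g is
   [die_poly]; the terms with j > m vanish. *)
Definition pow_coef (a : nat) (m n : int) : R :=
  \sum_(j < `|m|.+1) 'C(j + a, a)%:R * law j m * law j n.

(** The freedom in [B] allows several coefficients to be summed over one common range. *)
Lemma pow_coefE a (m n : int) (B : nat) : m < B%:Z ->
  pow_coef a m n = \sum_(j < B) 'C(j + a, a)%:R * law j m * law j n.
Proof.
have main (B1 B2 : nat) : (B1 <= B2)%N -> m < B1%:Z ->
    \sum_(j < B1) 'C(j + a, a)%:R * law j m * law j n =
    \sum_(j < B2) 'C(j + a, a)%:R * law j m * law j n.
  move=> leB ltmB.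
  rewrite (big_ord_widen B2 (fun j => 'C(j + a, a)%:R * law j m * law j n)) //.
  rewrite big_mkcond; apply: eq_bigr => j _; case: ltnP => // leBj.
  by rewrite law_eq0 ?mulr0 ?mul0r //; lia.
move=> ltmB; rewrite /pow_coef; case: (leqP B `|m|.+1) => [leB|/ltnW leB].
  by rewrite (main _ _ leB).
by rewrite -(main _ _ leB) //; lia.
Qed.

Lemma pow_coefC a m n : pow_coef a m n = pow_coef a n m.
Proof.
rewrite (@pow_coefE a m n (maxn `|m| `|n|).+1); last by lia.
rewrite (@pow_coefE a n m (maxn `|m| `|n|).+1); last by lia.
by apply: eq_bigr => j _; rewrite mulrAC.
Qed.

(** On generating functions this multiplies by H(x) g(y), where H is the sum of the [h r] x^(face
    r); the factor g(y) turns g(y)^j into g(y)^(j+1). It serves for H = g and for H = x g'. *)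
Lemma pow_coef_shift a m n (B : nat) (h : 'I_k -> R) : m < B%:Z ->
  \sum_(r < k) \sum_(s < k)
     h r * p s * pow_coef a (m - (face r)%:Z) (n - (face s)%:Z) =
  \sum_(j < B) 'C(j + a, a)%:R * (\sum_(r < k) h r * law j (m - (face r)%:Z))
                * law j.+1 n.
Proof.
move=> ltmB.
under [RHS]eq_bigr => j _.
  rewrite lawS -mulrA mulr_suml mulr_sumr.
  under eq_bigr do rewrite 2!mulr_sumr.
  over.
rewrite [RHS]exchange_big /=; apply: eq_bigr => r _.
rewrite [RHS]exchange_big /=; apply: eq_bigr => s _.
rewrite (@pow_coefE _ _ _ B) ?mulr_sumr; last by have := face_gt0 r; lia.
by apply: eq_bigr => j _; ring.
Qed.

(** With u = g(x) g(y), this is (1 - u)^(-a-1) = (1 - u) (1 - u)^(-a-2); on coefficients it is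
    Pascal's rule. *)
Lemma pow_coef_raise a m n :
  pow_coef a m n = pow_coef a.+1 m n -
  \sum_(r < k) \sum_(s < k)
     p r * p s * pow_coef a.+1 (m - (face r)%:Z) (n - (face s)%:Z).
Proof.
have ltmB : m < (`|m|.+1)%:Z by lia.
have ltmB1 : m < (`|m|.+2)%:Z by lia.
rewrite (pow_coef_shift _ _ _ ltmB) !(pow_coefE _ _ ltmB1).
rewrite [X in X = _]big_ord_recl [X in _ = X - _]big_ord_recl /= !binn.
rewrite -addrA -sumrB; congr (_ + _); apply: eq_bigr => j _.
rewrite -lawS /bump /= add1n -!mulrA -mulrBl -natrB; last first.
  by rewrite addSn; apply: leq_bin2l => //; lia.
by congr (_%:R * _); rewrite !addSn !addnS binS addKn.
Qed.

(** Multiplying by [m] is applying x d/dx, which sends (1 - u)^(-a-1) to (a+1) x g'(x) g(y) (1 -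
    u)^(-a-2), where u = g(x) g(y). *)
Lemma mul_pow_coefl a m n :
  m%:~R * pow_coef a m n = a.+1%:R * \sum_(r < k) \sum_(s < k)
     p r * (face r)%:R * p s * pow_coef a.+1 (m - (face r)%:Z) (n - (face s)%:Z).
Proof.
have ltmB : m < (`|m|.+1)%:Z by lia.
rewrite (@pow_coef_shift _ _ _ _ (fun r => p r * (face r)%:R) ltmB).
rewrite (@pow_coefE _ _ _ `|m|.+2); last by lia.
rewrite big_ord_recl mulrDr /= law0.
have -> : m%:~R * ('C(0 + a, a)%:R * (m == 0)%:R * law 0 n) = 0 :> R.
  by have [->|] := eqVneq m 0; rewrite ?mul0r // mulr0 mul0r mulr0.
rewrite add0r !mulr_sumr; apply: eq_bigr => j _; rewrite /bump /= add1n.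
have binE : (a.+1%:R * 'C(j + a.+1, a.+1)%:R = j.+1%:R * 'C(j.+1 + a, a)%:R :> R).
  by rewrite -!natrM mul_bin_left addnS -addSn addnK.
transitivity ('C(j.+1 + a, a)%:R * (m%:~R * law j.+1 m) * law j.+1 n); first by ring.
by rewrite mul_lawS !mulrA binE; ring.
Qed.

Lemma mul_pow_coefr a m n :
  n%:~R * pow_coef a m n = a.+1%:R * \sum_(r < k) \sum_(s < k)
     p r * (p s * (face s)%:R) * pow_coef a.+1 (m - (face r)%:Z) (n - (face s)%:Z).
Proof.
rewrite pow_coefC mul_pow_coefl exchange_big /=; congr (_ * _).
apply: eq_bigr => r _; apply: eq_bigr => s _.
by rewrite pow_coefC [p s * _]mulrC !mulrA; congr (_ * _); ring.
Qed.

(** * Spans of bounded degree over a fixed power of 1 - g(x) g(y) *)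

Variable C : nat.
Hypothesis face_le : forall r, (face r <= C)%N.

(** These are the coefficients of Q(x, y) / (1 - g(x) g(y))^(a+1), with Q of degree below [d] in
    each variable; [w] lists the coefficients of Q. *)
Definition in_span (a d : nat) (f : int -> int -> R) : Prop :=
  exists w : 'I_d * 'I_d -> R, forall m n,
    f m n = \sum_x w x * pow_coef a (m - (x.1 : nat)%:Z) (n - (x.2 : nat)%:Z).

Lemma in_span_ext a d f g :
  (forall m n, f m n = g m n) -> in_span a d g -> in_span a d f.
Proof. by move=> fg [w gE]; exists w => m n; rewrite fg gE. Qed.

Lemma in_span_gen a d (i j : nat) : (i < d)%N -> (j < d)%N ->
  in_span a d (fun m n => pow_coef a (m - i%:Z) (n - j%:Z)).
Proof.
move=> ltid ltjd; pose x0 := (Ordinal ltid, Ordinal ltjd).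
exists (fun x => (x == x0)%:R) => m n; rewrite (bigD1 x0) //= eqxx mul1r.
by rewrite big1 ?addr0 // => x /negPf ->; rewrite mul0r.
Qed.

Lemma in_spanZ a d c f : in_span a d f -> in_span a d (fun m n => c * f m n).
Proof.
move=> [w fE]; exists (fun x => c * w x) => m n; rewrite fE mulr_sumr.
by apply: eq_bigr => x _; rewrite mulrA.
Qed.

Lemma in_spanD a d f g : in_span a d f -> in_span a d g ->
  in_span a d (fun m n => f m n + g m n).
Proof.
move=> [w fE] [v gE]; exists (fun x => w x + v x) => m n.
by rewrite fE gE -big_split; apply: eq_bigr => x _; rewrite mulrDl.
Qed.

Lemma in_span_sum a d (I : finType) (f : I -> int -> int -> R) :
  (forall i, in_span a d (f i)) -> in_span a d (fun m n => \sum_i f i m n).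
Proof.
move=> /fin_all_exists[w fE]; exists (fun x => \sum_i w i x) => m n.
under eq_bigr do rewrite fE.
by rewrite exchange_big; apply: eq_bigr => x _; rewrite mulr_suml.
Qed.

(** Shifting the indices multiplies Q by x^i y^j. *)
Lemma in_span_shift a d e (i j : nat) f : (i <= e)%N -> (j <= e)%N ->
  in_span a d f -> in_span a (d + e) (fun m n => f (m - i%:Z) (n - j%:Z)).
Proof.
move=> leie leje [w fE]; apply: in_span_ext => [m n|]; first exact: fE.
apply: in_span_sum => x; apply: in_spanZ.
apply: (@in_span_ext _ _ _
  (fun m n => pow_coef a (m - (i + x.1)%N%:Z) (n - (j + x.2)%N%:Z))).
  by move=> m n; rewrite !PoszD !opprD !addrA.
by apply: in_span_gen; rewrite addnC -addSn leq_add.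
Qed.

Lemma in_span_conv a d (c : 'I_k -> 'I_k -> R) f : in_span a d f ->
  in_span a (d + C) (fun m n => \sum_(r < k) \sum_(s < k)
     c r s * f (m - (face r)%:Z) (n - (face s)%:Z)).
Proof.
move=> fP; apply: in_span_sum => r; apply: in_span_sum => s; apply: in_spanZ.
exact: in_span_shift.
Qed.

Lemma in_span_widen a d e f : in_span a d f -> in_span a (d + e) f.
Proof.
move=> /(@in_span_shift _ _ e 0 0 _ isT isT); apply: in_span_ext => m n.
by rewrite !subr0.
Qed.

(* Raising the order by one costs [C] in the degree, whether or not one
   multiplies by an affine form in the indices, that is, differentiates. *)
Lemma in_span_raise a d f : in_span a d f -> in_span a.+1 (d + C) f.
Proof.
move=> [w fE]; apply: in_span_ext fE _; apply: in_span_sum => x; apply: in_spanZ.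
pose g m n := pow_coef a.+1 (m - (x.1 : nat)%:Z) (n - (x.2 : nat)%:Z).
have gP : in_span a.+1 d g by exact: in_span_gen.
apply: (@in_span_ext _ _ _ (fun m n => g m n + (- 1) * \sum_(r < k) \sum_(s < k)
    p r * p s * g (m - (face r)%:Z) (n - (face s)%:Z))); last first.
  by apply: in_spanD; [exact: in_span_widen|apply: in_spanZ; exact: in_span_conv].
move=> m n; rewrite pow_coef_raise mulN1r; congr (_ - _).
by apply: eq_bigr => r _; apply: eq_bigr => s _; rewrite /g (addrAC m) (addrAC n).
Qed.

Lemma in_span_affine a d (u v t : R) f : in_span a d f ->
  in_span a.+1 (d + C) (fun m n => (u * m%:~R + v * n%:~R + t) * f m n).
Proof.
move=> [w fE].
apply: (@in_span_ext _ _ _ (fun m n => \sum_x w x * ((u * m%:~R + v * n%:~R + t) *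
    pow_coef a (m - (x.1 : nat)%:Z) (n - (x.2 : nat)%:Z)))).
  by move=> m n; rewrite fE mulr_sumr; apply: eq_bigr => x _; rewrite mulrCA.
apply: in_span_sum => x; apply: in_spanZ.
pose h m n := pow_coef a (m - (x.1 : nat)%:Z) (n - (x.2 : nat)%:Z).
pose g m n := pow_coef a.+1 (m - (x.1 : nat)%:Z) (n - (x.2 : nat)%:Z).
have hP : in_span a d h by exact: in_span_gen.
have gP : in_span a.+1 d g by exact: in_span_gen.
(* The affine form is recentred at the shifted indices: u (m - x.1) + v (n - x.2) plus a constant.
   The first two terms are derivatives, and the constant only needs its order raised. *)
apply: (@in_span_ext _ _ _ (fun m n =>
    (u * (x.1 : nat)%:R + v * (x.2 : nat)%:R + t) * h m n
    + (u * (a.+1%:R * \sum_(r < k) \sum_(s < k)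
         p r * (face r)%:R * p s * g (m - (face r)%:Z) (n - (face s)%:Z))
    + v * (a.+1%:R * \sum_(r < k) \sum_(s < k)
         p r * (p s * (face s)%:R) * g (m - (face r)%:Z) (n - (face s)%:Z))))); last first.
  apply: in_spanD; first by apply/in_spanZ/in_span_raise.
  by apply: in_spanD; apply/in_spanZ/in_spanZ; exact: in_span_conv.
move=> m n; rewrite -/(h m n).
have -> : a.+1%:R * (\sum_(r < k) \sum_(s < k)
         p r * (face r)%:R * p s * g (m - (face r)%:Z) (n - (face s)%:Z)) =
    (m%:~R - (x.1 : nat)%:R) * h m n.
  transitivity ((m - (x.1 : nat)%:Z)%:~R * h m n); last by rewrite rmorphB /= -pmulrn.
  rewrite mul_pow_coefl; congr (_ * _).
  by apply: eq_bigr => r _; apply: eq_bigr => s _; rewrite /g (addrAC m) (addrAC n).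
have -> : a.+1%:R * (\sum_(r < k) \sum_(s < k)
         p r * (p s * (face s)%:R) * g (m - (face r)%:Z) (n - (face s)%:Z)) =
    (n%:~R - (x.2 : nat)%:R) * h m n.
  transitivity ((n - (x.2 : nat)%:Z)%:~R * h m n); last by rewrite rmorphB /= -pmulrn.
  rewrite mul_pow_coefr; congr (_ * _).
  by apply: eq_bigr => r _; apply: eq_bigr => s _; rewrite /g (addrAC m) (addrAC n).
ring.
Qed.

(** A relation between the arrays of [d ^ 2] coefficients passes to the functions they represent. *)
Lemma in_span_dependence (I : finType) a d (v : I -> int -> int -> R) :
  (d ^ 2 < #|I|)%N -> (forall i, in_span a d (v i)) ->
  exists q : I -> R, (exists i, q i != 0) /\
    forall m n, \sum_i q i * v i m n = 0.
Proof.
move=> ltdI /fin_all_exists[w vE].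
have [|q [qN0 qw]] := @linear_dependence _ _ _ w.
  by rewrite card_prod card_ord.
exists q; split=> // m n; under eq_bigr do rewrite vE mulr_sumr.
rewrite exchange_big big1 //= => x _.
by under eq_bigr do rewrite mulrA; rewrite -mulr_suml qw mul0r.
Qed.

(** Since x^m y^n = s^(m-n) t^n, the power of [n] comes from (t d/dt)^b and the product from
    (d/ds)^c applied to s^(m-n-1). The resulting drop in the exponent of s is left out here. *)
Definition twisted (f : int -> int -> R) (b c : nat) (m n : int) : R :=
  n%:~R ^+ b * (\prod_(l < c) (m - n - l.+1%:Z)%:~R) * f m n.

(** Each of the b + c factors is affine in the indices and costs one order and [C] degrees. *)
Lemma in_span_twisted a d f b c : in_span a d f ->
  in_span (a + (b + c)) (d + (b + c) * C) (twisted f b c).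
Proof.
move=> fP; elim: b => [|b IH].
  elim: c => [|c IH].
    rewrite !addn0; apply: in_span_ext fP => m n.
    by rewrite /twisted big_ord0 expr0 !mul1r.
  rewrite [(0 + c.+1)%N]addnS addnS mulSn [(C + _)%N]addnC [(d + _)%N]addnA.
  apply: in_span_ext (in_span_affine 1 (-1) (- c.+1%:R) IH) => m n.
  rewrite /twisted big_ord_recr /= !rmorphB /= -pmulrn; ring.
rewrite addSn addnS mulSn [(C + _)%N]addnC [(d + _)%N]addnA.
apply: in_span_ext (in_span_affine 0 1 0 IH) => m n.
rewrite /twisted exprS; ring.
Qed.

(* Lipshitz's argument. In the variables s = x and t = x y, and up to a power
   of x, the function [v (a, b, c)] below is the coefficient of
   t^a (t d/dt)^b (d/ds)^c applied to s^-1 f. Extracting the coefficient of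
   s^(-1-c0), with c0 the least order in d/ds, from a dependence relation kills
   all terms but those with c = c0: [m] is evaluated at [n - c0 + N]. *)
Lemma diagonal_recurrence f : in_span 0 C.+1 f ->
  exists2 L : nat, (0 < L)%N &
  exists2 c : 'I_L.+1 -> {poly R}, (exists i, c i != 0) &
    forall n : int,
      \sum_(i < L.+1) (c i).[n%:~R] * f (n - i%:Z) (n - i%:Z) = 0.
Proof.
(* This makes the (N+1)^3 operators outnumber the ((C+1)(2N+1))^2 coefficients, which are at most 4
   (C+1)^2 (N+1)^2. *)
move=> fP; pose N := (4 * C.+1 ^ 2)%N.
(* The shift by [x.1.1] in both indices is t^a. The shift by [N - x.2] restores the drop in the
   exponent of s, up to a common factor s^(N+1). *)
pose v (x : 'I_N.+1 * 'I_N.+1 * 'I_N.+1) (m n : int) :=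
  twisted f x.1.2 x.2 (m - (N - x.2 + x.1.1)%N%:Z) (n - (x.1.1 : nat)%:Z).
have vP x : in_span (N + N) (C.+1 + (N + N) * C + (N + N)) (v x).
  apply: in_span_shift.
  - by have := ltn_ord x.1.1; have := ltn_ord x.2; lia.
  - by have := ltn_ord x.1.1; lia.
  have le_bc : (x.1.2 + x.2 <= N + N)%N.
    by have := ltn_ord x.1.2; have := ltn_ord x.2; lia.
  (* Operators of lower total order are raised to the common order 2N. *)
  have raise e a d g : in_span a d g -> in_span (a + e) (d + e * C) g.
    elim: e => [|e IH] gP; first by rewrite !addn0.
    by rewrite addnS mulSn [(C + _)%N]addnC addnA; apply/in_span_raise/IH.
  have := raise (N + N - (x.1.2 + x.2))%N _ _ _ (in_span_twisted x.1.2 x.2 fP).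
  by rewrite add0n subnKC // -addnA -mulnDl subnKC.
have [|q [[x0 qx0] qv]] := in_span_dependence _ vP.
  rewrite !card_prod !card_ord.
  have -> : (C.+1 + (N + N) * C + (N + N) = C.+1 * (N + N).+1)%N by lia.
  have : (C.+1 ^ 2 * 4 < N.+1)%N by rewrite /N; lia.
  have : ((N + N).+1 ^ 2 <= 4 * N.+1 ^ 2)%N by rewrite -!mulnn; lia.
  by rewrite expnMn -!mulnn; nia.
pose nz c := [exists x, (q x != 0) && (x.2 == c :> nat)].
have exnz : exists c, nz c by exists x0.2; apply/existsP; exists x0; rewrite qx0 /=.
case: (ex_minnP exnz) => c0 /existsP[[[a1 b1] c1] /= /andP[q1 /eqP c1E]] c0min.
exists N; first by rewrite /N; lia.
(* The factor (n - a)^b comes from [twisted] at the second index n - a, hence the composition with X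
   - a. *)
exists (fun a : 'I_N.+1 => (\poly_(b < N.+1) q (a, inord b, c1)) \Po ('X - (a : nat)%:R%:P)).
  exists a1; rewrite comp_poly2_eq0; last by rewrite size_XsubC.
  apply/eqP => /polyP/(_ b1); rewrite coef_poly ltn_ord inord_val coef0 => q10.
  by rewrite q10 eqxx in q1.
move=> n; have := qv (n - c0%:Z + N%:Z) n.
pose K : R := \prod_(l < c0) (- l.+1%:Z)%:~R.
have KN0 : K != 0.
  by apply/prodf_neq0 => l _; rewrite intr_eq0.
have vE (x : 'I_N.+1 * 'I_N.+1 * 'I_N.+1) : q x * v x (n - c0%:Z + N%:Z) n =
    if x.2 == c1 then K * (q x * (n - (x.1.1 : nat)%:Z)%:~R ^+ x.1.2 *
        f (n - (x.1.1 : nat)%:Z) (n - (x.1.1 : nat)%:Z)) else 0.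
  have -> : v x (n - c0%:Z + N%:Z) n =
      twisted f x.1.2 x.2 (n - (x.1.1 : nat)%:Z + ((x.2 : nat)%:Z - c0%:Z))
         (n - (x.1.1 : nat)%:Z).
    by rewrite /v; congr (twisted _ _ _ _ _); have := ltn_ord x.2; lia.
  have -> : (x.2 == c1) = (x.2 == c0 :> nat) by rewrite -c1E.
  rewrite /twisted; case: (ltngtP x.2 c0) => [ltc|ltc|->].
  - have [->|qxN0] := eqVneq (q x) 0; first by rewrite mul0r.
    have : nz x.2 by apply/existsP; exists x; rewrite qxN0 eqxx.
    by move=> /c0min; rewrite leqNgt ltc.
  (* Here the two indices differ by x.2 - c0, so the factor of rank l = x.2 - c0 - 1 in the product
     vanishes. *)
  - have ltl : (x.2 - c0.+1 < x.2)%N by lia.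
    rewrite (bigD1 (Ordinal ltl)) //=.
    set z := (X in X%:~R * _); have -> : z = 0 by rewrite /z; lia.
    by rewrite !(mul0r, mulr0).
  - rewrite subrr addr0; set y := n - _.
    have -> : \prod_(l < c0) (y - y - l.+1%:Z)%:~R = K :> R.
      by apply: eq_bigr => l _; rewrite subrr add0r.
    by rewrite [_ * K]mulrC -!mulrA mulrCA.
rewrite (eq_bigr _ (fun x _ => vE x)).
rewrite -big_mkcond -mulr_sumr => /eqP; rewrite mulf_eq0 (negPf KN0) /= => /eqP sum0.
pose G (a b : 'I_N.+1) := q (a, b, c1) *
   (n - (a : nat)%:Z)%:~R ^+ b * f (n - (a : nat)%:Z) (n - (a : nat)%:Z).
transitivity (\sum_ab G ab.1 ab.2); last first.
  rewrite -[RHS]sum0 [RHS](reindex (fun ab => (ab, c1))) /=.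
    by apply: eq_big => [x|[a b] _] //; rewrite eqxx.
  by exists fst => [x|[x c] /eqP /= ->].
rewrite -(pair_bigA _ G) /=.
apply: eq_bigr => a _; rewrite horner_comp hornerXsubC horner_poly mulr_suml.
by apply: eq_bigr => b _; rewrite inord_val /G rmorphB /= -pmulrn.
Qed.

(** * Exit probabilities of the solitaire game *)

(* [exit_prob j n] is the probability that the sum of [j] rolls is below [n]
   and that of [j + 1] rolls is not: if the last roll is [r], the former sum
   is one of the [face r] numbers preceding [n]. *)
Definition exit_prob (j : nat) (z : int) : R :=
  \sum_(r < k) p r * \sum_(u < face r) law j (z - u.+1%:Z).

(** This is the coefficient of x^m y^n in the series F, written through [pow_coef] so that it
    visibly lies in a span. *)
Definition exit_corr (m n : int) : R :=
  \sum_(r < k) \sum_(u < face r) \sum_(s < k) \sum_(v < face s)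
    p r * p s * pow_coef 0 (m - u.+1%:Z) (n - v.+1%:Z).

Lemma exit_corrE m n (B : nat) : m <= B%:Z ->
  exit_corr m n = \sum_(j < B) exit_prob j m * exit_prob j n.
Proof.
move=> lemB.
transitivity (\sum_(j < B) \sum_(r < k) \sum_(u < face r) \sum_(s < k) \sum_(v < face s)
    p r * p s * (law j (m - u.+1%:Z) * law j (n - v.+1%:Z))).
  rewrite [RHS]exchange_big; apply: eq_bigr => r _.
  rewrite [RHS]exchange_big; apply: eq_bigr => u _.
  rewrite [RHS]exchange_big; apply: eq_bigr => s _.
  rewrite [RHS]exchange_big; apply: eq_bigr => v _.
  rewrite (@pow_coefE _ _ _ B); last by lia.
  by rewrite mulr_sumr; apply: eq_bigr => j _; rewrite bin0 mul1r.
apply: eq_bigr => j _; rewrite /exit_prob mulr_suml; apply: eq_bigr => r _.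
rewrite -mulrA mulr_suml mulr_sumr; apply: eq_bigr => u _.
rewrite 2!mulr_sumr; apply: eq_bigr => s _.
by rewrite !mulr_sumr; apply: eq_bigr => v _; ring.
Qed.

Lemma in_span_exit_corr : in_span 0 C.+1 exit_corr.
Proof.
apply: in_span_sum => r; apply: in_span_sum => u; apply: in_span_sum => s.
apply: in_span_sum => v; apply/in_spanZ/in_span_gen.
  by rewrite ltnS (leq_trans _ (face_le r)).
by rewrite ltnS (leq_trans _ (face_le s)).
Qed.

Lemma exit_prob_eq0 j z : z <= j%:Z -> exit_prob j z = 0.
Proof.
move=> lezj; rewrite /exit_prob big1 // => r _; rewrite big1 ?mulr0 // => u _.
by rewrite law_eq0 //; lia.
Qed.

(** The sum of [law j] over the e indices preceding n is a difference of two cumulative sums;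
    averaging the second one over the last roll gives that of [law j.+1]. *)
Lemma exit_prob_sub j (n : nat) : \sum_(r < k) p r = 1 ->
  exit_prob j n%:Z = \sum_(m < n) law j m%:Z - \sum_(m < n) law j.+1 m%:Z.
Proof.
move=> p1; have tele (e : nat) : \sum_(u < e) law j (n%:Z - u.+1%:Z) =
    \sum_(m < n) law j m%:Z - \sum_(m < n) law j (m%:Z - e%:Z).
  elim: n => [|n IH].
    rewrite !big_ord0 subr0 big1 // => u _; rewrite law_eq0 //; lia.
  rewrite !big_ord_recr /= opprD addrACA -IH; clear IH; elim: e => [|e IH].
    by rewrite !big_ord0 subr0 subrr addr0.
  rewrite !big_ord_recr /= IH.
  have -> : n.+1%:Z - e.+1%:Z = n%:Z - e%:Z by lia.
  ring.
rewrite /exit_prob; under eq_bigr do rewrite tele mulrBr.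
rewrite sumrB -mulr_suml p1 mul1r; congr (_ - _).
under [RHS]eq_bigr do rewrite lawS.
by rewrite [RHS]exchange_big; apply: eq_bigr => r _; rewrite mulr_sumr.
Qed.

(** Expanding g^j by distributivity gives one monomial per vector of [j] outcomes. *)
Lemma sum_law_ffun j (n : nat) :
  \sum_(m < n) law j m%:Z =
  \sum_(e : {ffun 'I_j -> 'I_k} | (\sum_i face (e i) < n)%N) \prod_i p (e i).
Proof.
have polyE : die_poly ^+ j = \sum_(e : {ffun 'I_j -> 'I_k})
    (\prod_i p (e i)) *: 'X^(\sum_i face (e i)).
  rewrite -[in LHS](card_ord j) -prodr_const /die_poly.
  rewrite (bigA_distr_bigA (fun _ r => p r *: 'X^(face r))).
  apply: eq_bigr => e _; rewrite -[RHS]mul_polyC rmorph_prod expr_sum.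
  by rewrite -big_split; apply: eq_bigr => i _; rewrite /= mul_polyC.
rewrite [RHS]big_mkcond /=.
under eq_bigr do rewrite /law polyE coef_sum.
rewrite exchange_big; apply: eq_bigr => e _.
under eq_bigr do rewrite coefZ coefXn.
rewrite -mulr_sumr; case: ltnP => h.
  rewrite (bigD1 (Ordinal h)) //= eqxx [X in _ + X]big1 ?addr0 ?mulr1 // => m.
  by rewrite -val_eqE => /negPf /= ->.
rewrite [X in _ * X]big1 ?mulr0 // => m _; case: eqP => // mE.
by have := ltn_ord m; rewrite mE ltnNge h.
Qed.

End DieLaw.

(** * Law of the rolls *)

(** The disjoint pieces have total mass 1, though they may miss a null set. Additivity bounds P(E)
    and P(~E) from below by sums that add up to 1, so both bounds are equalities. *)
Lemma prob_partition (R : realType) (d : measure_display)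
    (T : measurableType d) (P : probability T R) (Z : finType)
    (C : Z -> set T) (c : Z -> R) (E : set T) (Q : pred Z) :
  (forall z, measurable (C z)) -> trivIset setT C ->
  (forall z, P (C z) = (c z)%:E) -> \sum_z c z = 1 ->
  measurable E -> (forall z w, C z w -> (E w <-> Q z)) ->
  fine (P E) = \sum_(z | Q z) c z.
Proof.
move=> mC tC PC c1 mE EQ.
have le_sum (F : set T) (q : pred Z) : measurable F ->
    (forall z, q z -> C z `<=` F) -> \sum_(z | q z) c z <= fine (P F).
  move=> mF CF; rewrite -lee_fin fineK ?fin_num_measure //.
  rewrite -sumEFin; under eq_bigr do rewrite -PC.
  have -> : (\sum_(z | q z) P (C z) = \sum_(z <- enum q) P (C z))%E by rewrite big_enum.
  rewrite fsbig_seq ?enum_uniq // -measure_fin_bigcup //.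
  - apply: le_measure; rewrite ?inE //.
      by apply: fin_bigcup_measurable => //; exact: finite_seq.
    by move=> w [z /= zq]; apply: CF; move: zq; rewrite mem_enum.
  - exact: sub_trivIset tC.
have leE : \sum_(z | Q z) c z <= fine (P E).
  by apply: le_sum => // z Qz w /EQ ->.
have : \sum_(z | ~~ Q z) c z <= fine (P (~` E)).
  apply: le_sum => [|z /negP NQz w Cw Ew]; first exact: measurableC.
  by apply: NQz; apply/(EQ _ _ Cw).
rewrite probability_setC // fineB ?fin_num_measure //=.
move: c1; rewrite (bigID Q) /= => c1 leNE; apply: le_anti; rewrite leE andbT; lra.
Qed.

Definition csum (s : nat -> nat) (j : nat) : nat := (\sum_(t < j) s t)%N.

Lemma csumS s j : csum s j.+1 = (csum s j + s j)%N.
Proof. by rewrite /csum big_ord_recr. Qed.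

Lemma leq_csum s i j : (i <= j)%N -> (csum s i <= csum s j)%N.
Proof.
move=> /subnKC <-; elim: (j - i)%N => [|e IH]; first by rewrite addn0.
by rewrite addnS csumS (leq_trans IH) ?leq_addr.
Qed.

Lemma eq_csum s s' j : (forall t, (t < j)%N -> s t = s' t) -> csum s j = csum s' j.
Proof. by move=> ss'; apply: eq_bigr => t _; exact: ss'. Qed.

Lemma csum_ge s j : (forall t, (t < j)%N -> (0 < s t)%N) -> (j <= csum s j)%N.
Proof.
elim: j => // j IH s_gt0; rewrite csumS -addn1 leq_add ?s_gt0 //.
by apply: IH => t ltj; apply: s_gt0; rewrite ltnS ltnW.
Qed.

Section Rolls.
Variables (R : realType) (d : measure_display) (T : measurableType d).
Variables (P : probability T R) (X : nat -> {RV P >-> nat}).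

Definition cylinder (M : nat) (v : nat -> nat) : set T :=
  [set w | forall t, (t < M)%N -> X t w = v t].

Lemma cylinderE M v : cylinder M v =
  \bigcap_(t in [set` seq_fset tt (iota 0 M)]) (X t @^-1` [set v t]).
Proof.
have memE t : (t \in seq_fset tt (iota 0 M)) = (t < M)%N.
  by rewrite seq_fsetE mem_iota.
apply/seteqP; split=> w cw t ltM; apply: cw; first by rewrite -memE.
by apply/idP; rewrite memE.
Qed.

Lemma measurable_cylinder M v : measurable (cylinder M v).
Proof.
rewrite cylinderE; apply: fin_bigcap_measurable => // t _.
exact: measurable_funPTI.
Qed.

Lemma prob_cylinder M v : mutually_independent X ->
  P (cylinder M v) = (\prod_(t < M) P (X t @^-1` [set v t]))%E.
Proof.
move=> indep; rewrite cylinderE indep //.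
have /(perm_big _) -> : perm_eq (seq_fset tt (iota 0 M)) (iota 0 M).
  by rewrite -[X in perm_eq _ X]undup_id ?iota_uniq // seq_fset_perm.
by rewrite -[M in iota 0 M]subn0 -/(index_iota 0 M) big_mkord.
Qed.

(** An event decided by the first [M] rolls is the union of the cylinders it contains, and finite
    sequences of naturals are countable. *)
Lemma measurable_rolls M (E : set T) :
  (forall w w', (forall t, (t < M)%N -> X t w = X t w') -> E w -> E w') ->
  measurable E.
Proof.
move=> Edep.
have -> : E = \bigcup_(s : seq nat)
    (if `[< cylinder M (nth 0%N s) `<=` E >] then cylinder M (nth 0%N s) else set0).
  apply/seteqP; split=> [w Ew|w [s _]]; last by case: asboolP => // sE /sE.
  have cw : cylinder M (nth 0%N (mkseq (fun t => X t w) M)) w.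
    by move=> t ltM; rewrite nth_mkseq.
  exists (mkseq (fun t => X t w) M) => //; case: asboolP => // -[] w' cw'.
  by apply: Edep Ew => t ltM; rewrite cw' // cw.
apply: countable_bigcupT_measurable => [|s]; first exact: countableP.
by case: ifP => // _; exact: measurable_cylinder.
Qed.

Lemma capitalE j w : capital X j w = csum (X ^~ w) j.
Proof. by []. Qed.

(** Of [t] joint rolls, the first mover has made t/2 rounded up and the opponent t/2 rounded
    down. *)
Lemma player_capitalE w t :
  player_capital X false t w = csum (fun i => X i.*2 w) (uphalf t) /\
  player_capital X true t w = csum (fun i => X i.*2.+1 w) t./2.
Proof.
have pcS b u : player_capital X b u.+1 w =
    (player_capital X b u w + if odd u == b then X u w else 0)%N.
  by rewrite /player_capital big_mkcond big_ord_recr -big_mkcond.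
elim: t => [|t [IH1 IH2]]; first by rewrite /player_capital /csum !big_ord0.
rewrite !pcS IH1 IH2 /= !uphalf_half.
have := odd_double_half t; case: (odd t) => /= tE; split; rewrite ?addn0 //.
  by rewrite csumS -[_.*2.+1]add1n tE.
by rewrite add0n csumS; rewrite add0n in tE; rewrite tE.
Qed.

Lemma measurable_capital_lt j n : measurable [set w | (capital X j w < n)%N].
Proof.
apply: (@measurable_rolls j) => w w' Xww' /=.
by rewrite !capitalE (eq_csum Xww').
Qed.

(** Capitals never decrease, so only the last one before the exit has to be tested. *)
Lemma solitaire_takesS n j : solitaire_takes X n j.+1 =
  [set w | (capital X j w < n)%N] `\` [set w | (capital X j.+1 w < n)%N].
Proof.
apply/seteqP; split=> w /=.
  by move=> [leq_n lt_n]; split; [exact: lt_n|apply/negP; rewrite -leqNgt].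
move=> [lt_n /negP]; rewrite -leqNgt => le_n; split=> // i; rewrite ltnS => leij.
exact: leq_ltn_trans (leq_csum (X ^~ w) leij) lt_n.
Qed.

Lemma solitaire_probS j n : solitaire_prob X j.+1 n =
  fine (P [set w | (capital X j w < n)%N]) -
  fine (P [set w | (capital X j.+1 w < n)%N]).
Proof.
have mlt := measurable_capital_lt.
rewrite /solitaire_prob solitaire_takesS measureD //; last first.
  by rewrite -ge0_fin_numE ?fin_num_measure.
rewrite fineB ?fin_num_measure //; last exact: measurableI.
congr (_ - fine (P _)); apply/seteqP; split=> [w [] //|w /= lt_n]; split=> //=.
exact: leq_ltn_trans (leq_csum (X ^~ w) (leqnSn j)) lt_n.
Qed.

Lemma measurable_first_wins n : measurable (first_wins X n).
Proof.
have -> : first_wins X n = \bigcup_t [set w | (n <= player_capital X false t w)%N /\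
                           (player_capital X true t w < n)%N].
  by apply/seteqP; split=> [w [t tP]|w [t _ tP]]; exists t.
apply: bigcupT_measurable => t; apply: (@measurable_rolls t) => w w' Xww' /=.
have pcE b : player_capital X b t w = player_capital X b t w'.
  by apply: eq_bigr => u _; exact: Xww'.
by rewrite !pcE.
Qed.

Variables (k : nat) (face : 'I_k -> nat) (p : 'I_k -> R).
Hypothesis face_inj : injective face.
Hypothesis face_gt0 : forall r : 'I_k, (0 < face r)%N.
Hypothesis p_sum1 : \sum_(r < k) p r = 1.
Hypothesis X_rolls : die_rolls face p X.

(** Past [M] the sequence takes the default value 0; only its first [M] terms are ever compared with
    rolls. *)
Definition rolls_of M (e : {ffun 'I_M -> 'I_k}) (t : nat) : nat :=
  oapp (fun i => face (e i)) 0%N (insub t).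

Lemma rolls_of_ord M (e : {ffun 'I_M -> 'I_k}) (i : 'I_M) :
  rolls_of e i = face (e i).
Proof. by rewrite /rolls_of valK. Qed.

Lemma rolls_of_inj M (e e' : {ffun 'I_M -> 'I_k}) :
  (forall t, (t < M)%N -> rolls_of e t = rolls_of e' t) -> e = e'.
Proof.
move=> ee'; apply/ffunP => i; apply: face_inj.
by rewrite -!rolls_of_ord ee'.
Qed.

Lemma rolls_of_gt0 M (e : {ffun 'I_M -> 'I_k}) t : (t < M)%N -> (0 < rolls_of e t)%N.
Proof. by move=> ltM; rewrite -[t]/(nat_of_ord (Ordinal ltM)) rolls_of_ord. Qed.

Lemma sum_prod_ffun M : \sum_(e : {ffun 'I_M -> 'I_k}) \prod_i p (e i) = 1.
Proof.
rewrite -(bigA_distr_bigA (fun _ r => p r)) /=.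
by rewrite big1 // => i _; exact: p_sum1.
Qed.

Lemma prob_face t M (e : {ffun 'I_M -> 'I_k}) (i : 'I_M) :
  P (X t @^-1` [set rolls_of e i]) = (p (e i))%:E.
Proof. by rewrite rolls_of_ord; exact: X_rolls.2. Qed.

(** Injectivity of [face] makes the cylinders disjoint, independence gives their masses, and these
    sum to 1. *)
Lemma prob_rolls M (E : set T) (Q : pred {ffun 'I_M -> 'I_k}) : measurable E ->
  (forall e w, cylinder M (rolls_of e) w -> (E w <-> Q e)) ->
  fine (P E) = \sum_(e | Q e) \prod_i p (e i).
Proof.
apply: prob_partition => [e||e|].
- exact: measurable_cylinder.
- move=> e e' _ _ [w [we we']]; apply: rolls_of_inj => t ltM.
  by rewrite -we // -we'.
- rewrite prob_cylinder; last exact: X_rolls.1.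
  by rewrite -prodEFin; apply: eq_bigr => i _; exact: prob_face.
- exact: sum_prod_ffun.
Qed.

(** * The two players as one interleaved sequence of rolls *)

Definition interleave (s s' : nat -> nat) (t : nat) : nat :=
  if odd t then s' t./2 else s t./2.

Lemma prod_double (V : comPzSemiRingType) (h : nat -> V) M :
  \prod_(t < M.*2) h t = \prod_(i < M) (h i.*2 * h i.*2.+1).
Proof.
elim: M => [|M IH]; first by rewrite !big_ord0.
by rewrite doubleS !big_ord_recr /= IH mulrA.
Qed.

Lemma prob_two_rolls M (E : set T)
    (Q : pred ({ffun 'I_M -> 'I_k} * {ffun 'I_M -> 'I_k})) : measurable E ->
  (forall e w, cylinder M.*2 (interleave (rolls_of e.1) (rolls_of e.2)) w ->
     (E w <-> Q e)) ->
  fine (P E) = \sum_(e | Q e) (\prod_i p (e.1 i)) * \prod_i p (e.2 i).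
Proof.
apply: prob_partition => [e||[e1 e2]|].
- exact: measurable_cylinder.
- move=> [e1 e2] [e1' e2'] _ _ [w [we we']] /=.
  have eqX t : (t < M.*2)%N -> interleave (rolls_of e1) (rolls_of e2) t =
      interleave (rolls_of e1') (rolls_of e2') t by move=> ltM; rewrite -we // -we'.
  congr (_, _); apply: rolls_of_inj => t ltM.
    by have := eqX t.*2; rewrite ltn_double /interleave odd_double doubleK; apply.
  by have := eqX t.*2.+1; rewrite ltn_Sdouble /interleave /= odd_double uphalf_double; apply.
- rewrite prob_cylinder; last exact: X_rolls.1.
  rewrite -big_split /=.
  transitivity (\prod_(t < M.*2)
      (fine (P (X t @^-1` [set interleave (rolls_of e1) (rolls_of e2) t])))%:E)%E.
    apply: eq_bigr => t _; rewrite fineK // fin_num_measure //.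
    exact: measurable_funPTI.
  rewrite prodEFin (prod_double (fun t =>
    fine (P (X t @^-1` [set interleave (rolls_of e1) (rolls_of e2) t])))).
  congr EFin; apply: eq_bigr => i _.
  by rewrite /interleave /= odd_double doubleK uphalf_double /= !prob_face.
- rewrite -(pair_bigA _ (fun e1 e2 : {ffun 'I_M -> 'I_k} =>
    (\prod_i p (e1 i)) * \prod_i p (e2 i))) /=.
  under eq_bigr do rewrite -mulr_sumr sum_prod_ffun mulr1.
  exact: sum_prod_ffun.
Qed.

(** Allowing [M] beyond [j] puts the events for different [j] on one space of outcome vectors. *)
Lemma prob_capital_lt M j n : (j <= M)%N ->
  fine (P [set w | (capital X j w < n)%N]) =
  \sum_(e : {ffun 'I_M -> 'I_k} | (csum (rolls_of e) j < n)%N) \prod_i p (e i).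
Proof.
move=> lejM; apply: prob_rolls => [|e w cw /=]; first exact: measurable_capital_lt.
by rewrite capitalE (@eq_csum _ (rolls_of e)) // => t ltj; apply: cw; lia.
Qed.

Lemma prob_capital_ltE j n :
  fine (P [set w | (capital X j w < n)%N]) = \sum_(m < n) law face p j m%:Z.
Proof.
rewrite (prob_capital_lt _ (leqnn j)) sum_law_ffun; apply: eq_bigl => e.
by congr (_ < n)%N; apply: eq_bigr => i _; exact: rolls_of_ord.
Qed.

Lemma solitaire_probE j n : solitaire_prob X j.+1 n = exit_prob face p j n%:Z.
Proof. by rewrite solitaire_probS !prob_capital_ltE exit_prob_sub. Qed.

Lemma sum_sq_probE n :
  sum_sq_prob X n = \sum_(j < n) exit_prob face p j n%:Z ^+ 2.
Proof.
rewrite /sum_sq_prob; apply: (@lim_near_cst R^o (@norm_hausdorff _ R^o)).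
(* From this bound on the partial sums are constant, the exit after more than n rolls being
   impossible. *)
exists n.+1 => // B /= ltnB; rewrite big_add1 big_mkord.
rewrite [RHS](big_ord_widen B.-1 (fun j => exit_prob face p j n%:Z ^+ 2)); last by lia.
rewrite [RHS]big_mkcond; apply: eq_bigr => j _; rewrite solitaire_probE.
case: ltnP => // lenj.
by rewrite exit_prob_eq0 ?expr0n.
Qed.

(** The index [j] marks the first mover's crossing at roll j + 1, when the opponent has made [j]
    rolls; positive faces bring both players to [n] within n rolls each. *)
Lemma first_winsE n (e : {ffun 'I_n -> 'I_k} * {ffun 'I_n -> 'I_k}) w :
  (0 < n)%N -> cylinder n.*2 (interleave (rolls_of e.1) (rolls_of e.2)) w ->
  first_wins X n w <-> [exists j : 'I_n,
    (csum (rolls_of e.1) j < n <= csum (rolls_of e.1) j.+1)%N &&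
    (csum (rolls_of e.2) j < n)%N].
Proof.
case: e => e1 e2 /= n_gt0 cw.
have s1E j : (j <= n)%N -> csum (fun i => X i.*2 w) j = csum (rolls_of e1) j.
  move=> lejn; apply: eq_csum => t ltj.
  by rewrite cw ?ltn_double ?(leq_trans ltj) // /interleave odd_double doubleK.
have s2E j : (j <= n)%N -> csum (fun i => X i.*2.+1 w) j = csum (rolls_of e2) j.
  move=> lejn; apply: eq_csum => t ltj.
  rewrite cw ?ltn_Sdouble ?(leq_trans ltj) //.
  by rewrite /interleave /= odd_double uphalf_double.
split.
  move=> [t]; rewrite (player_capitalE w t).1 (player_capitalE w t).2 => -[le1 lt2].
  have ltn2 : (t./2 < n)%N.
    rewrite ltnNge; apply: contraL lt2 => len; rewrite -leqNgt.
    apply: leq_trans (leq_csum _ len); rewrite s2E //.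
    by apply: csum_ge => i; exact: rolls_of_gt0.
  (* The least such index is positive because [n] is; its predecessor is the required [j]. *)
  have ex1 : exists j, (n <= csum (fun i => X i.*2 w) j)%N by exists (uphalf t).
  case: (ex_minnP ex1) => -[|j]; first by rewrite /csum big_ord0; lia.
  move=> lej jmin.
  have lejt : (j <= t./2)%N.
    by have := jmin _ le1; rewrite uphalf_half; case: (odd t) => /=; lia.
  have ltjn := leq_ltn_trans lejt ltn2.
  apply/existsP; exists (Ordinal ltjn) => /=.
  rewrite -!s1E ?(ltnW ltjn) // -s2E ?(ltnW ltjn) // lej andbT.
  rewrite (leq_ltn_trans (leq_csum _ lejt) lt2) andbT ltnNge.
  by apply/negP => /jmin; rewrite ltnn.
move=> /existsP[j /andP[/andP[_ le1] lt2]]; exists j.*2.+1.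
rewrite (player_capitalE w _).1 (player_capitalE w _).2 /= uphalf_double doubleK.
by rewrite s1E // s2E // ltnW.
Qed.

Lemma first_win_probE n : (0 < n)%N ->
  first_win_prob X n = (1 + sum_sq_prob X n) / 2.
Proof.
move=> n_gt0; pose B j := fine (P [set w | (capital X j w < n)%N]).
have sqE : sum_sq_prob X n = \sum_(j < n) (B j - B j.+1) ^+ 2.
  rewrite sum_sq_probE; apply: eq_bigr => j _.
  by rewrite -solitaire_probE solitaire_probS.
have B0 : B 0%N = 1.
  rewrite /B (_ : [set w | _] = setT) ?probability_setT //.
  by apply/seteqP; split=> // w _ /=; rewrite capitalE /csum big_ord0.
have Bn : B n = 0.
  by rewrite /B prob_capital_ltE big1 // => m _; rewrite law_eq0 // ltz_nat.
pose in1 (e : {ffun 'I_n -> 'I_k}) (j : nat) : bool :=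
  (csum (rolls_of e) j < n <= csum (rolls_of e) j.+1)%N.
pose in2 (e : {ffun 'I_n -> 'I_k}) (j : nat) : bool := (csum (rolls_of e) j < n)%N.
(* The first mover crosses [n] at most once, so the indicator of the existential is a sum of
   indicators. *)
have indE (e1 e2 : {ffun 'I_n -> 'I_k}) :
    [exists j : 'I_n, in1 e1 j && in2 e2 j]%:R =
    \sum_(j < n) (in1 e1 j)%:R * (in2 e2 j)%:R :> R.
  case: existsP => [[j /andP[j1 j2]]|nex]; last first.
    rewrite big1 // => j _; rewrite -natrM mulnb.
    by case: andP => // -[h1 h2]; case: nex; exists j; rewrite h1.
  rewrite (bigD1 j) //= j1 j2 mulr1 big1 ?addr0 // => i; rewrite -val_eqE /= => neij.
  suff -> : in1 e1 i = false by rewrite mul0r.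
  apply/negP => /andP[lti lei]; move: j1 => /andP[ltj lej].
  by case: (ltngtP i j) neij => // lt_ij _; have := leq_csum (rolls_of e1) lt_ij; lia.
have in1E (j : nat) : (j < n)%N ->
    \sum_(e : {ffun 'I_n -> 'I_k}) (\prod_i p (e i)) * (in1 e j)%:R = B j - B j.+1.
  move=> ltjn; rewrite /B !(@prob_capital_lt n) ?(ltnW ltjn) //.
  rewrite [X in _ = X - _]big_mkcond [X in _ = _ - X]big_mkcond -sumrB; apply: eq_bigr => e _; rewrite /in1.
  have := leq_csum (rolls_of e) (leqnSn j).
  by do 2 case: ltnP => ? /=; rewrite ?mulr1 ?mulr0 ?subr0 ?subrr //; lia.
have in2E (j : nat) : (j < n)%N ->
    \sum_(e : {ffun 'I_n -> 'I_k}) (\prod_i p (e i)) * (in2 e j)%:R = B j.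
  move=> ltjn; rewrite /B (@prob_capital_lt n) ?(ltnW ltjn) //.
  rewrite [RHS]big_mkcond; apply: eq_bigr => e _; rewrite /in2.
  by case: ltnP; rewrite ?mulr1 ?mulr0.
have winE : first_win_prob X n = \sum_(j < n) (B j - B j.+1) * B j.
  rewrite /first_win_prob (@prob_two_rolls n _
    (fun e => [exists j : 'I_n, in1 e.1 j && in2 e.2 j])); last first.
  - by move=> e w; exact: first_winsE.
  - exact: measurable_first_wins.
  transitivity (\sum_(e1 : {ffun 'I_n -> 'I_k}) \sum_(e2 : {ffun 'I_n -> 'I_k})
      \sum_(j < n) ((\prod_i p (e1 i)) * (in1 e1 j)%:R) *
                   ((\prod_i p (e2 i)) * (in2 e2 j)%:R)).
    rewrite pair_bigA big_mkcond; apply: eq_bigr => -[e1 e2] _ /=.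
    under [RHS]eq_bigr do rewrite mulrACA.
    by rewrite -mulr_sumr -indE; case: ifP; rewrite ?mulr1 ?mulr0.
  under eq_bigr do rewrite exchange_big.
  rewrite exchange_big; apply: eq_bigr => j _.
  rewrite -(in1E j) // -(in2E j) // mulr_suml; apply: eq_bigr => e1 _.
  by rewrite mulr_sumr.
have tele : \sum_(j < n) (B j.+1 ^+ 2 - B j ^+ 2) = - 1.
  rewrite -(big_mkord xpredT (fun j => B j.+1 ^+ 2 - B j ^+ 2)) telescope_sumr //.
  by rewrite B0 Bn; ring.
apply: (mulIf (_ : 2 != 0 :> R)) => //; rewrite mulfVK //.
rewrite sqE winE mulr_suml -[X in _ = X + _]opprK -tele -sumrN -big_split.
by apply: eq_bigr => j _ /=; ring.
Qed.

End Rolls.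

(** * Transfer of P-recursiveness and conclusion *)

(* The recurrence of [u] gives one for [v] with a polynomial right-hand side [h];
   combining it with its shift, with factors [h(n - 1)] and [h(n)], removes [h]. *)
Lemma P_recursive_affine (R : realType) (u v : nat -> R) (a b : R) :
  (forall n, (0 < n)%N -> v n = a * u n + b) -> P_recursive u -> P_recursive v.
Proof.
move=> vE [L [L_gt0 [c [[i0 ci0] urec]]]].
pose h : {poly R} := b *: \sum_(i < L.+1) c i.
have vrec n : (L < n)%N -> \sum_(i < L.+1) (c i).[n%:R] * v (n - i)%N = h.[n%:R].
  move=> ltLn; transitivity (\sum_(i < L.+1) (a * ((c i).[n%:R] * u (n - i)%N)
      + b * (c i).[n%:R])).
    apply: eq_bigr => i _; rewrite vE; first by ring.
    by have := ltn_ord i; lia.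
  rewrite big_split /= -!mulr_sumr urec // mulr0 add0r.
  by rewrite hornerZ horner_sum.
have [h0|hN0] := eqVneq h 0.
  exists L; split=> //; exists c; split; first by exists i0.
  by move=> n ltLn; rewrite vrec // h0 horner0.
pose sh : {poly R} := 'X - 1%:P.
have shN0 q : q != 0 -> q \Po sh != 0.
  by rewrite comp_poly2_eq0 // size_XsubC.
pose cx (i : nat) : {poly R} := if (i < L.+1)%N then c (inord i) else 0.
have cxE (i : 'I_L.+1) : cx i = c i by rewrite /cx ltn_ord inord_val.
have ex0 : exists i, cx i != 0 by exists i0; rewrite cxE.
(* At the least index [m] with a nonzero coefficient the shifted recurrence contributes nothing, so
   the combined one has the nonzero coefficient h(n - 1) c_m(n) there. *)
case: (ex_minnP ex0) => m cxm mmin.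
have ltmL : (m < L.+1)%N by apply: contraNT cxm => /negPf; rewrite /cx => ->.
exists L.+1; split=> //.
exists (fun i : 'I_L.+2 => (h \Po sh) * cx i -
   h * (if (i : nat) is i'.+1 then cx i' \Po sh else 0)); split.
  exists (inord m); rewrite inordK; last by lia.
  suff -> : (if m is m'.+1 then cx m' \Po sh else 0) = 0.
    by rewrite mulr0 subr0 mulf_neq0 ?shN0.
  case: (m) mmin => // m' mmin; have [->|/mmin] := eqVneq (cx m') 0.
    by rewrite comp_poly0.
  by rewrite ltnn.
move=> n ltLn; have n1E : n%:R - 1 = n.-1%:R :> R.
  by rewrite -[in LHS](ltn_predK ltLn) -natr1 addrK.
under eq_bigr do rewrite hornerD hornerN !hornerM mulrBl horner_comp hornerXsubC n1E -!mulrA.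
rewrite sumrB -!mulr_sumr.
have -> : \sum_(i < L.+2) (cx i).[n%:R] * v (n - i)%N = h.[n%:R].
  rewrite big_ord_recr /= [cx L.+1]/cx ltnn horner0 mul0r addr0 -vrec; last by lia.
  by apply: eq_bigr => i _; rewrite cxE.
have -> : \sum_(i < L.+2) (if (i : nat) is i'.+1 then cx i' \Po sh else 0).[n%:R]
    * v (n - i)%N = h.[n.-1%:R].
  rewrite big_ord_recl /= horner0 mul0r add0r -vrec; last by lia.
  apply: eq_bigr => i _; rewrite /bump /= add1n cxE horner_comp hornerXsubC n1E.
  by congr (_ * v _); lia.
by rewrite mulrC subrr.
Qed.

Theorem theorem4 (R : realType) (k : nat) (face : 'I_k -> nat) (p : 'I_k -> R)
    (face_inj : injective face)
    (face_gt0 : forall r : 'I_k, (0 < face r)%N)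
    (p_gt0 : forall r : 'I_k, 0 < p r)
    (p_sum1 : \sum_(r < k) p r = 1)
    (d : measure_display) (T : measurableType d) (P : probability T R)
    (X : nat -> {RV P >-> nat})
    (X_rolls : die_rolls face p X) :
  (forall n : nat, (0 < n)%N ->
     first_win_prob X n = (1 + sum_sq_prob X n) / 2%:R) /\
  P_recursive (sum_sq_prob X) /\
  P_recursive (first_win_prob X).
Proof.
have winE n := @first_win_probE R d T P X k face p face_inj face_gt0 p_sum1 X_rolls n.
have sq_rec : P_recursive (sum_sq_prob X).
  have face_le r : (face r <= \max_(s < k) face s)%N by exact: leq_bigmax.
  have [L L_gt0 [c cN0 crec]] := diagonal_recurrence face_gt0 face_le
    (in_span_exit_corr p face_le).
  exists L; split=> //; exists c; split=> // n ltLn.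
  rewrite -[RHS](crec n%:Z); apply: eq_bigr => i _; rewrite -pmulrn.
  have leLn : (i <= n)%N by have := ltn_ord i; lia.
  (* On the diagonal, truncating at the index itself leaves exactly the finite sum of squares equal
     to [sum_sq_prob]. *)
  rewrite subzn // (exit_corrE p face_gt0 _ (lexx _)).
  by rewrite (sum_sq_probE face_inj face_gt0 p_sum1 X_rolls).
split=> //; split=> //.
apply: (P_recursive_affine _ sq_rec) => n n_gt0.
by rewrite winE // mulrDl addrC mulrC.
Qed.
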